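(* For $k=1$ let $\mathcal M_1^{\mathrm{Stela}}$ be the program: minimize $z$ over $P\in\mathcal F$, $z\ge0$ subject to $\lambda(a,t;P)\le z$ for all $(a,t)\in\mathcal A_T$. For $2\le k\le N$ let $\mathcal M_k^{\mathrm{Stela}}$ be the program: minimize $z$ over $P\in\mathcal F$, $z\ge0$, and $y=(y^{(j)}_{a,t})$ subject to (1) $\lambda(a,t;P)\le\bar\lambda_1$ for all $(a,t)\in\mathcal A_T$; (2) $\lambda(a,t;P)\le\bar\lambda_j+(\bar\lambda_1-\bar\lambda_j)\,y^{(j)}_{a,t}$ for all $(a,t)\in\mathcal A_T$, $2\le j<k$; (3) $\sum_{(a,t)\in\mathcal A_T}y^{(j)}_{a,t}\le j-1$ for $2\le j<k$; (4) $\lambda(a,t;P)\le z+\bar\lambda_1\,y^{(k)}_{a,t}$ for all $(a,t)\in\mathcal A_T$; (5) $\sum_{(a,t)\in\mathcal A_T}y^{(k)}_{a,t}\le k-1$; (6) $0\le z\le\bar\lambda_{k-1}$; (7) $y^{(j)}_{a,t}\in\{0,1\}$ for all $(a,t)\in\mathcal A_T$, $2\le j\le k$. Then for every $k\in\mathcal K$ the optimal value of $\mathcal M_k^{\mathrm{Stela}}$ is $\bar\lambda_k=\min_{P\in\mathcal F_{k-1}}\lambda^{\downarrow}_k(P)$, and the routing scheme $P_k^\star$ read from any optimal solution belongs to $\mathcal F_k$.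
   Context: Setting ($T$-ASR instance). $G=(V,A)$ is a finite directed graph with arc weights $\omega:A\to\mathbb Q_{>0}$ and capacities $c:A\to\mathbb Q_{>0}$. $T=\{0,\dots,h-1\}$ with $h\ge1$, $T^*=T\setminus\{0\}$. $q:T\to2^A$ with $q(0)=\varnothing$ gives the unavailable arcs, $G_t=(V,A\setminus q(t))$. $\mathcal A_T=\{(a,t):t\in T,\ a\in A\setminus q(t)\}$, $N=|\mathcal A_T|$, $\mathcal K=\{1,\dots,N\}$. $D$ is a finite set of demands; demand $d$ has source $s_d\in V$ and target $t_d\in V$. $\nu:D\times T\to\mathbb Q_{\ge0}$ are traffic volumes, $\kappa:T^*\to\mathbb N$ reconfiguration budgets, $\mathrm{maxSeg}\ge2$ an integer. Split coefficients: the forwarding graph from $u$ to $v$ at time $t$ consists of the arcs of $G_t$ lying on $\omega$-shortest $u$–$v$ paths in $G_t$. $r(u,v,a,t)\ge0$ is the fraction of a unit flow from $u$ to $v$ that uses arc $a$ when the flow entering each vertex is split equally among its outgoing arcs in this forwarding graph; $r(u,v,a,t)=0$ if $a$ is not in it. Segment paths: a segment valid at $t$ is a pair $(i,j)$, $i\ne j$, with $j$ reachable from $i$ in $G_t$. A segment path of $d$ at $t$ is a node sequence $\langle s_d=v_0,v_1,\dots,v_m=t_d\rangle$, $1\le m\le\mathrm{maxSeg}$, whose segments $(v_{l-1},v_l)$ are valid at $t$ and pairwise distinct (nodes may repeat). $\delta(p,ij)=1$ if $p$ contains segment $(i,j)$, else $0$. $\operatorname{dist}(p,p')=\sum_{i\ne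 j}|\delta(p,ij)-\delta(p',ij)|$. $\mathcal F$ is the set of routing schemes $P=(p_d^t)_{d\in D,t\in T}$ ($p_d^t$ a segment path of $d$ at $t$) with $\sum_{d\in D}\operatorname{dist}(p_d^{t-1},p_d^{t})\le\kappa(t)$ for all $t\in T^*$; $\mathcal F$ is assumed non-empty (it is finite). Loads: $\lambda(a,t;P)=\frac1{c(a)}\sum_{d\in D}\sum_{i,j}r(i,j,a,t)\,\nu(d,t)\,\delta(p_d^t,ij)$ for $(a,t)\in\mathcal A_T$; $\lambda^{\downarrow}(P)=(\lambda^{\downarrow}_1(P)\ge\dots\ge\lambda^{\downarrow}_N(P))$ is the load vector sorted in non-increasing order. Recursion: $\mathcal F_0=\mathcal F$ and, for $k\ge1$, $\bar\lambda_k=\min_{P\in\mathcal F_{k-1}}\lambda^{\downarrow}_k(P)$, $\mathcal F_k=\{P\in\mathcal F_{k-1}:\lambda^{\downarrow}_k(P)=\bar\lambda_k\}$. *)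

(* Defs.v *)
From HB Require Import structures.
From mathcomp Require Import all_boot all_order all_algebra.

Set Implicit Arguments.
Unset Strict Implicit.
Unset Printing Implicit Defensive.

Import Order.TTheory GRing.Theory Num.Theory.

Local Open Scope ring_scope.

(* Times are 'I_h, that is 0, ..., h-1.  The arc set is a type with tail and
   head maps, so parallel arcs are allowed but not required.  The budget
   kappa is only ever used at times t > 0. *)
Record tasr (V A D : finType) (h : nat) := Tasr {
  horizon_gt0 : (0 < h)%N;
  tail : A -> V;
  head : A -> V;
  weight : A -> rat;
  weight_gt0 : forall a, 0 < weight a;
  cap : A -> rat;
  cap_gt0 : forall a, 0 < cap a;
  unavail : 'I_h -> {set A};
  unavail0 : forall t : 'I_h, t = 0 :> nat -> unavail t = set0;
  src : D -> V;
  dst : D -> V;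
  traffic : D -> 'I_h -> rat;
  traffic_ge0 : forall d t, 0 <= traffic d t;
  kappa : 'I_h -> nat;
  maxSeg : nat;
  maxSeg_ge2 : (2 <= maxSeg)%N
}.

(* The value of f at a minimizer over S; the default 0 is reached only for
   empty S, see minoverP. *)
Definition minover (X : finType) (S : {set X}) (f : X -> rat) : rat :=
  if [pick x in S | [forall y in S, f x <= f y]] is Some x then f x else 0.

Lemma minoverP (X : finType) (S : {set X}) (f : X -> rat) :
  S != set0 ->
  (exists2 x, x \in S & f x = minover S f) /\
  (forall x, x \in S -> minover S f <= f x).
Proof.
case/set0Pn=> x0 Sx0; rewrite /minover; case: pickP => [x /andP[Sx /forallP xP]|].
  by split=> [|y Sy]; [exists x | move: (xP y); rewrite Sy].
case: (@Order.TotalTheory.arg_minP _ _ _ x0 (mem S) f Sx0) => x Sx xP.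
move/(_ x)/negP; case; apply/andP; split=> //.
by apply/forall_inP => y Sy; apply: xP.
Qed.

Section Instance.

Variables (V A D : finType) (h : nat) (I : tasr V A D h).

Implicit Types (u v : V) (a : A) (t : 'I_h) (d : D).

Definition avail_at : {set A * 'I_h} := [set e | e.1 \notin unavail I e.2].

Fixpoint diwalk u v (w : seq A) : bool :=
  if w is a :: w' then (tail I a == u) && diwalk (head I a) v w' else u == v.

Definition dipath t u v (w : seq A) : bool :=
  [&& diwalk u v w, all (fun a => a \notin unavail I t) w
    & uniq (u :: map (head I) w)].

Lemma size_dipath t u v w : dipath t u v w -> (size w < #|V|)%N.
Proof.
case/and3P=> _ _ /card_uniqP /=; rewrite size_map => <-; exact: max_card.
Qed.

Definition wlength (w : seq A) : rat := \sum_(a <- w) weight I a.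

(* By size_dipath, bounding the length by #|V| loses no path. *)
Definition shortest t u v (w : {bseq #|V| of A}) : bool :=
  dipath t u v w &&
  [forall w' : {bseq #|V| of A}, dipath t u v w' ==> (wlength w <= wlength w')].

Definition fwd t u v : {set A} :=
  [set a | [exists w : {bseq #|V| of A}, shortest t u v w && (a \in (w : seq A))]].

Definition fwd_outdeg t u v (x : V) : nat := #|[set a in fwd t u v | tail I a == x]|.

(* Flow entering x when one unit is injected at u and split equally at every
   vertex, along walks of at most n arcs.  Since the weights are positive, the
   forwarding graph is acyclic, and n = #|V| accounts for the whole flow. *)
Fixpoint entering (n : nat) t u v (x : V) : rat :=
  (x == u)%:R +
  (if n is n'.+1 then
     \sum_(a in fwd t u v | head I a == x)
        entering n' t u v (tail I a) / (fwd_outdeg t u v (tail I a))%:R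
   else 0).

Definition split_coef u v a t : rat :=
  if a \in fwd t u v then
    entering #|V| t u v (tail I a) / (fwd_outdeg t u v (tail I a))%:R
  else 0.

Definition arc_rel t : rel V :=
  fun x y => [exists a, [&& a \notin unavail I t, tail I a == x & head I a == y]].

Definition valid_segment t (s : V * V) : bool :=
  (s.1 != s.2) && connect (arc_rel t) s.1 s.2.

Definition segments (p : seq V) : seq (V * V) := zip p (behead p).

(* p lists the m + 1 nodes of a segment path with m segments. *)
Definition segment_path d t (p : seq V) : bool :=
  [&& (2 <= size p <= (maxSeg I).+1)%N,
      ohead p == Some (src I d), last (src I d) p == dst I d,
      all (valid_segment t) (segments p) & uniq (segments p)].

Definition delta (p : seq V) (i j : V) : nat := (i, j) \in segments p.

Definition dist (p p' : seq V) : nat :=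
  (\sum_i \sum_(j | i != j) `|delta p i j - delta p' i j|)%N.

Definition scheme : finType :=
  {ffun D * 'I_h -> {bseq (maxSeg I).+1 of V}}.

Implicit Type P : scheme.

Definition schemes : {set scheme} :=
  [set P : scheme |
    [forall d, forall t, segment_path d t (P (d, t))] &&
    [forall t : 'I_h, forall t' : 'I_h, (t' == t.+1 :> nat) ==>
       (\sum_d dist (P (d, t)) (P (d, t')) <= kappa I t')%N]].

Definition load P (e : A * 'I_h) : rat :=
  (cap I e.1)^-1 *
  \sum_d \sum_i \sum_j
     split_coef i j e.1 e.2 * traffic I d e.2 * (delta (P (d, e.2)) i j)%:R.

(* k-th largest load, counted from k = 1. *)
Definition sorted_load (k : nat) P : rat :=
  nth 0 (sort (fun x y => y <= x) [seq load P e | e <- enum avail_at]) k.-1.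

Fixpoint lexopt (k : nat) : {set scheme} :=
  if k is k'.+1 then
    [set P in lexopt k' |
       sorted_load k P == minover (lexopt k') (sorted_load k)]
  else schemes.

(* Meaningful for k >= 1. *)
Definition lambar (k : nat) : rat := minover (lexopt k.-1) (sorted_load k).

Section Program.

Variable R : realFieldType.

(* Constraint y in {0,1} is carried by the type.  Only the entries y j e with
   2 <= j <= k and e in avail_at are variables of the k-th program; in
   particular it has no y variable for k = 1. *)
Record stela_var := StelaVar {
  sv_P : scheme;
  sv_z : R;
  sv_y : nat -> A * 'I_h -> bool
}.

Definition stela1_feasible (s : stela_var) : Prop :=
  let: StelaVar P z _ := s in
  [/\ P \in schemes, 0 <= z &
      forall e, e \in avail_at -> ratr (load P e) <= z].

Definition stela_ge2_feasible (k : nat) (s : stela_var) : Prop :=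
  let: StelaVar P z y := s in
  P \in schemes /\
  [/\ forall e, e \in avail_at -> load P e <= lambar 1,
      forall j e, (2 <= j < k)%N -> e \in avail_at ->
        load P e <= lambar j + (lambar 1 - lambar j) * (y j e)%:R,
      forall j, (2 <= j < k)%N -> (\sum_(e in avail_at) y j e <= j - 1)%N,
      forall e, e \in avail_at ->
        ratr (load P e) <= z + ratr (lambar 1) * (y k e)%:R &
      (\sum_(e in avail_at) y k e <= k - 1)%N /\
      0 <= z <= ratr (lambar k.-1)].

Definition stela_feasible (k : nat) (s : stela_var) : Prop :=
  if k == 1%N then stela1_feasible s else stela_ge2_feasible k s.

End Program.

End Instance.

Section Optimization.

Variables (S : Type) (R : realFieldType) (feasible : S -> Prop) (obj : S -> R).

Definition optimal_solution (s : S) : Prop :=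
  feasible s /\ forall s', feasible s' -> obj s <= obj s'.

Definition optimal_value (v : R) : Prop :=
  (exists2 s, feasible s & obj s = v) /\ forall s, feasible s -> v <= obj s.

End Optimization.

(* Main.v *)
(* The k-th largest load is at most x iff at most k - 1 loads exceed x.  The
   binary y^(j) marks a superset of the pairs whose load exceeds the j-th
   threshold, so constraints (1)-(3) say that the j-th largest load of P is at
   most the j-th optimum for every j < k, i.e. that P lies in F_(k-1), while
   (4)-(5) say that the k-th largest load is at most z.  Conversely, marking
   exactly the pairs above the thresholds turns any element of F_k into a
   feasible solution. *)
Require Import Defs.
From mathcomp Require Import all_boot all_order all_algebra.

Set Implicit Arguments.
Unset Strict Implicit.
Unset Printing Implicit Defensive.

Import Order.TTheory GRing.Theory Num.Theory.

Local Open Scope ring_scope.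

(** Since [p] is upward closed, the elements satisfying it form a prefix of the non-increasing list,
    of length [count p s]; index [k] lies past that prefix exactly when this length is at most
    [k]. *)
Lemma nth_sort_ge_count (p : pred rat) (s : seq rat) (k : nat) :
  (forall x y, x <= y -> p x -> p y) -> (k < size s)%N ->
  ~~ p (nth 0 (sort (fun x y => y <= x) s) k) = (count p s <= k)%N.
Proof.
move=> p_mono; pose ge := fun x y : rat => y <= x.
have ge_trans : transitive ge by move=> y x z xy yz; apply: le_trans yz xy.
have: sorted ge (sort ge s) by apply: sort_sorted => x y; apply: le_total.
rewrite -(size_sort ge) -(permP (permEl (perm_sort ge s)) p) -/ge.
elim: (sort ge s) k => {s} [|a s IHs] //= k pa_s; have s_sorted := path_sorted pa_s.
have [pa|npa] := boolP (p a).
  case: k => [|k] /= lt_k_s; first by rewrite pa.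
  exact: IHs.
(* Once the head fails [p], all later and smaller elements fail too, so the count is 0. *)
have npas : all (predC p) (a :: s).
  rewrite /= npa; apply/allP => x /(allP (order_path_min ge_trans pa_s)) xa.
  by apply: contra npa => /(p_mono _ _ xa).
move=> lt_k_s; have /= -> := allP npas _ (mem_nth 0 (lt_k_s : k < size (a :: s))%N).
have := npas; rewrite all_predC has_count -leqNgt leqn0 /= (negbTE npa).
by move=> /eqP ->.
Qed.

Section Lexicographic.

Variables (V A D : finType) (h : nat) (I : tasr V A D h).

Implicit Types (P : scheme I) (p : pred rat) (e : A * 'I_h).

Lemma entering_ge0 n t u v x : 0 <= entering I n t u v x.
Proof.
elim: n x => [|n IHn] x /=; first by rewrite addr0 ler0n.
by rewrite addr_ge0 ?ler0n // sumr_ge0 // => a _; rewrite divr_ge0 ?ler0n.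
Qed.

Lemma split_coef_ge0 u v a t : 0 <= split_coef I u v a t.
Proof.
by rewrite /split_coef; case: ifP => // _; rewrite divr_ge0 ?ler0n ?entering_ge0.
Qed.

Lemma load_ge0 P e : 0 <= load P e.
Proof.
rewrite mulr_ge0 ?invr_ge0 ?(ltW (cap_gt0 I _)) //.
do 3!apply: sumr_ge0 => ? _.
by rewrite !mulr_ge0 ?split_coef_ge0 ?traffic_ge0 ?ler0n.
Qed.

Lemma sorted_load_count p k P :
  (forall x y, x <= y -> p x -> p y) -> (0 < k <= #|avail_at I|)%N ->
  ~~ p (sorted_load k P) = (\sum_(e in avail_at I) p (load P e) <= k - 1)%N.
Proof.
move=> p_mono /andP[k_gt0 k_le]; rewrite /sorted_load nth_sort_ge_count //.
  by rewrite subn1 -sum1_count big_map big_enum_cond /= -big_mkcondr.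
by rewrite size_map -cardE prednK.
Qed.

(** An abstract [p] covers both thresholds in [rat] and the test [z < ratr q], where [z] lies in [R]
    and may be no rational. *)
Lemma sorted_load_mark p k P (y : pred (A * 'I_h)) :
  (forall x x', x <= x' -> p x -> p x') -> (0 < k <= #|avail_at I|)%N ->
  (\sum_(e in avail_at I) y e <= k - 1)%N ->
  (forall e, e \in avail_at I -> p (load P e) -> y e) ->
  ~~ p (sorted_load k P).
Proof.
move=> p_mono k_range sum_y p_y; rewrite sorted_load_count //.
apply: leq_trans sum_y; apply: leq_sum => e e_av.
by have := p_y e e_av; case: (p _) => // ->.
Qed.

Lemma sorted_load_le_count x k P : (0 < k <= #|avail_at I|)%N ->
  (sorted_load k P <= x) = (\sum_(e in avail_at I) (x < load P e)%R <= k - 1)%N.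
Proof.
by rewrite leNgt => /sorted_load_count -> // u v /[swap]; apply: lt_le_trans.
Qed.

Lemma load_le_sorted_load1 P e : e \in avail_at I -> load P e <= sorted_load 1 P.
Proof.
move=> e_av; have av_gt0 : (0 < 1 <= #|avail_at I|)%N.
  by apply/card_gt0P; exists e.
(* With the largest load itself as threshold, at most 1 - 1 = 0 loads exceed it. *)
have := sorted_load_le_count (sorted_load 1 P) P av_gt0.
rewrite lexx subnn leqn0 sum_nat_eq0 => /esym/forall_inP/(_ e e_av).
by rewrite eqb0 -leNgt.
Qed.

Lemma sorted_load_ge0 k P : (0 < k <= #|avail_at I|)%N -> 0 <= sorted_load k P.
Proof.
case/andP=> k_gt0 k_le; set s := [seq load P e | e <- enum (avail_at I)].
(* For [k] in range the default of [nth] is not reached, so the value is an actual load. *)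
have /mapP[e _ ->]: sorted_load k P \in s; last exact: load_ge0.
by rewrite -(mem_sort (fun x y => y <= x)) mem_nth // size_sort size_map -cardE prednK.
Qed.

Lemma le_sorted_load j k P : (0 < j <= k)%N -> (k <= #|avail_at I|)%N ->
  sorted_load k P <= sorted_load j P.
Proof.
case/andP=> j_gt0 le_jk k_le; have k_gt0 := leq_trans j_gt0 le_jk.
rewrite sorted_load_le_count ?k_gt0 //.
apply: leq_trans (leq_sub2r 1 le_jk); rewrite -sorted_load_le_count //.
by rewrite j_gt0 (leq_trans le_jk).
Qed.

Hypothesis schemes_neq0 : schemes I != set0.

Lemma lexopt_neq0 k : lexopt I k != set0.
Proof.
elim: k => [|k IHk] //=.
have [[P Pk Pmin] _] := minoverP (sorted_load k.+1) IHk.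
by apply/set0Pn; exists P; rewrite inE Pk Pmin eqxx.
Qed.

Lemma lambar_le k P : P \in lexopt I k -> lambar I k.+1 <= sorted_load k.+1 P.
Proof. exact: (minoverP (sorted_load k.+1) (lexopt_neq0 k)).2. Qed.

Lemma lexopt_sorted_load k j P : P \in lexopt I k -> (0 < j <= k)%N ->
  sorted_load j P = lambar I j.
Proof.
elim: k => [|k IHk] /=; first by case: j.
rewrite inE => /andP[Pk /eqP eqP] /andP[j_gt0].
by rewrite leq_eqVlt => /predU1P[->|lt_jk] //; apply: IHk; rewrite // j_gt0.
Qed.

Lemma lexopt_schemes k P : P \in lexopt I k -> P \in schemes I.
Proof. by elim: k => //= k IHk; rewrite inE => /andP[/IHk]. Qed.

(** One-sided bounds suffice: once [P] lies in the previous set, minimality supplies the reverse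
    inequality. This is why constraints that only bound loads from above can describe the
    recursion. *)
Lemma mem_lexopt k P : P \in schemes I ->
  (forall j, (0 < j <= k)%N -> sorted_load j P <= lambar I j) ->
  P \in lexopt I k.
Proof.
move=> PF; elim: k => // k IHk Ple; rewrite /= inE.
have Pk : P \in lexopt I k.
  by apply: IHk => j /andP[j_gt0 le_jk]; rewrite Ple // j_gt0 leqW.
by rewrite Pk eq_le Ple ?leqnn // lambar_le.
Qed.

Lemma lambar_ge0 k : (0 < k <= #|avail_at I|)%N -> 0 <= lambar I k.
Proof.
move=> k_range; have /andP[k_gt0 _] := k_range; have /set0Pn[P Pk] := lexopt_neq0 k.
by rewrite -(lexopt_sorted_load Pk) ?k_gt0 ?leqnn // sorted_load_ge0.
Qed.

(** A single scheme in [lexopt I k] realizes both optima as its own sorted loads, which are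
    ordered. *)
Lemma le_lambar j k : (0 < j <= k)%N -> (k <= #|avail_at I|)%N ->
  lambar I k <= lambar I j.
Proof.
move=> jk k_le; have /andP[j_gt0 le_jk] := jk; have /set0Pn[P Pk] := lexopt_neq0 k.
rewrite -!(lexopt_sorted_load Pk) ?(leq_trans j_gt0) ?leqnn //.
exact: le_sorted_load.
Qed.

Section Program.

Variable R : realFieldType.

Implicit Types s : stela_var I R.

Lemma stela_feasible_bound k s : (0 < k <= #|avail_at I|)%N ->
  stela_feasible k s ->
  sv_P s \in lexopt I k.-1 /\ ratr (sorted_load k (sv_P s)) <= sv_z s.
Proof.
case: s => P z y k_range; rewrite /stela_feasible /=.
have ratr_mono (x : R) u v : u <= v -> x < ratr u -> x < ratr v.
  by rewrite -(ler_rat R) => /[swap]; apply: lt_le_trans.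
have gt_mono (x u v : rat) : u <= v -> x < u -> x < v.
  by move=> /[swap]; apply: lt_le_trans.
case: eqP k_range => [-> | /eqP k_neq1] k_range.
  case=> PF z_ge0 P_le; split=> //; rewrite leNgt.
  apply: (sorted_load_mark (p := fun q => z < ratr q) (y := pred0)) => //.
  - exact: ratr_mono.
  - by rewrite big1.
  - by move=> e /P_le; rewrite leNgt => /negbTE ->.
have /andP[k_gt0 k_le] := k_range.
case=> PF [P_le1 P_lej sum_yj P_lek [sum_yk _]]; split.
  apply: mem_lexopt => // j /andP[j_gt0 le_jk].
  have lt_jk : (j < k)%N by rewrite -(prednK k_gt0).
  have j_range : (0 < j <= #|avail_at I|)%N by rewrite j_gt0 (leq_trans (ltnW lt_jk)).
  (* The index 1 has no binaries; constraint (1) acts as the case where nothing is marked. *)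
  rewrite leNgt; have [j_eq1|j_neq1] := eqVneq j 1%N.
    apply: (sorted_load_mark (p := fun q => _ < q) (y := pred0)) => //.
    - exact: gt_mono.
    - by rewrite big1.
    - by move=> e /P_le1; rewrite j_eq1 leNgt => /negbTE ->.
  have j_range2 : (2 <= j < k)%N by rewrite lt_jk ltn_neqAle eq_sym j_neq1 j_gt0.
  apply: (sorted_load_mark (p := fun q => _ < q) (y := y j)) => //.
  - exact: gt_mono.
  - exact: sum_yj.
  (* At an unmarked pair the relaxation term vanishes, so the load respects the threshold. *)
  - move=> e e_av; apply: contraTT => /negbTE ye.
    by have := P_lej j e j_range2 e_av; rewrite ye mulr0 addr0 -leNgt.
rewrite leNgt; apply: (sorted_load_mark (p := fun q => z < ratr q) (y := y k)) => //.
- exact: ratr_mono.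
- move=> e e_av; apply: contraTT => /negbTE ye.
  by have := P_lek e e_av; rewrite ye mulr0 addr0 -leNgt.
Qed.

Lemma stela_feasible_lexopt k P : (0 < k <= #|avail_at I|)%N ->
  P \in lexopt I k ->
  stela_feasible k
    (StelaVar P (ratr (lambar I k) : R) (fun j e => lambar I j < load P e)).
Proof.
move=> k_range Pk; have /andP[k_gt0 k_le] := k_range.
have PF := lexopt_schemes Pk.
have P_eq := lexopt_sorted_load Pk.
have P_le1 e : e \in avail_at I -> load P e <= lambar I 1.
  by move=> /(load_le_sorted_load1 P); rewrite P_eq // k_gt0.
have lamk_ge0 : 0 <= ratr (lambar I k) :> R by rewrite ler0q lambar_ge0.
have sum_y j : (0 < j <= k)%N ->
    (\sum_(e in avail_at I) (lambar I j < load P e)%R <= j - 1)%N.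
  move=> j_range; have /andP[j_gt0 le_jk] := j_range.
  by rewrite -sorted_load_le_count ?j_gt0 ?(leq_trans le_jk) // P_eq.
rewrite /stela_feasible; case: eqP lamk_ge0 => [-> | /eqP k_neq1] lamk_ge0 /=.
  split=> //.
  by move=> e /P_le1; rewrite ler_rat.
have k_gt1 : (1 < k)%N by rewrite ltn_neqAle eq_sym k_neq1.
split=> //; split=> //.
(* At a marked pair the right-hand side is [lambar I 1], which bounds every load of [P]. *)
- move=> j e _ /P_le1 e_le1; case: ltP => [_|]; last by rewrite mulr0 addr0.
  by rewrite mulr1 addrC subrK.
- by move=> j /andP[j_gt1 /ltnW lt_jk]; apply: sum_y; rewrite ltnW.
(* Here a marked pair gets [lambar I k + lambar I 1], large enough because [lambar I k] is
   nonnegative. *)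
- move=> e /P_le1 e_le1; case: ltP => [_|]; last by rewrite mulr0 addr0 ler_rat.
  by rewrite mulr1 (le_trans (y := ratr (lambar I 1))) ?ler_rat ?lerDr.
- split; first by rewrite sum_y // k_gt0 leqnn.
  by rewrite lamk_ge0 ler_rat le_lambar // leq_pred andbT -ltnS prednK.
Qed.

End Program.

End Lexicographic.

Theorem theorem2 (R : realFieldType) (V A D : finType) (h : nat)
    (I : tasr V A D h) (F_neq0 : schemes I != set0)
    (k : nat) (hk : (1 <= k <= #|avail_at I|)%N) :
  optimal_value (@stela_feasible _ _ _ _ I R k) (@sv_z _ _ _ _ I R)
    (ratr (lambar I k)) /\
  (forall s : stela_var I R,
     optimal_solution (@stela_feasible _ _ _ _ I R k) (@sv_z _ _ _ _ I R) s ->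
     sv_P s \in lexopt I k).
Proof.
have bound (s : stela_var I R) : stela_feasible k s -> ratr (lambar I k) <= sv_z s.
  move=> s_feasible; have [sk1] := stela_feasible_bound F_neq0 hk s_feasible.
  apply: le_trans; move: sk1.
  have /andP[k_gt0 _] := hk; rewrite ler_rat -(prednK k_gt0).
  exact: lambar_le.
have /set0Pn[P Pk] := lexopt_neq0 F_neq0 k.
have P_feasible := stela_feasible_lexopt F_neq0 R hk Pk.
split=> [|s [s_feasible s_opt]].
  by split=> //; apply: ex_intro2 P_feasible _.
(* Comparison with the feasible point built from [P] gives [sv_z s <= ratr (lambar I k)], so the
   [k]-th load of [sv_P s] is at most the minimum over [lexopt I k.-1], hence equal to it. *)
have [sk1 s_le] := stela_feasible_bound F_neq0 hk s_feasible.
have /andP[k_gt0 _] := hk; move: sk1 (le_trans s_le (s_opt _ P_feasible)).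
rewrite /= ler_rat -(prednK k_gt0) /= inE => sk1 s_lek.
by rewrite sk1 eq_le s_lek lambar_le.
Qed.
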